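(* For every positive integer $n$, the number of permutations of $[n]$ having a positive up-down sequence is $[(n-1)!!]^2$ if $n$ is even and $n!!\,(n-2)!!$ if $n$ is odd. The number of permutations of $[n]$ having a Dyck up-down sequence is $(n-1)!!\,(n-3)!!$ if $n$ is even and $0$ if $n$ is odd.
   Context: For a permutation $\sigma=\sigma_1\ldots\sigma_n$ of $[n]=\{1,\ldots,n\}$, an ascent is an index $i<n$ with $\sigma_i<\sigma_{i+1}$ and a descent is an index $i<n$ with $\sigma_i>\sigma_{i+1}$. The permutation has a positive up-down sequence if for all $j\le n$ the number of ascents less than $j$ is at most the number of descents less than $j$. It has a Dyck up-down sequence if it has exactly one more ascent than descents but for all $j<n$ the number of ascents less than $j$ is at most the number of descents less than $j$. Double factorials: $m!!=m(m-2)(m-4)\cdots$ down to $1$ or $2$ for $m\ge1$, with the convention $0!!=(-1)!!=1$. *)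

(* Defs.v *)
From mathcomp Require Import all_boot all_order all_fingroup.
Set Implicit Arguments. Unset Strict Implicit. Unset Printing Implicit Defensive.

(* Double factorial: dfact m = m!!, with 0!! = 1!! = 1.  Since nat subtraction
   truncates, (n-2)!! at n = 1 and (n-3)!! at n = 2 evaluate to 0!! = 1,
   matching the convention (-1)!! = 1. *)
Fixpoint dfact (m : nat) : nat :=
  match m with
  | 0 => 1
  | 1 => 1
  | (m'.+2) as k => k * dfact m'
  end.

(* One-line notation sigma_1 ... sigma_n: the value at 1-based position i is
   s (i-1) (+1); we compare values, so the shift is irrelevant. *)
Definition pval n (s : {perm 'I_n}) (k : nat) : nat :=
  match insub k with Some i => val (s i) | None => 0 end.

(* 1-based index i (1 <= i < n) is an ascent iff sigma_i < sigma_{i+1} *)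
Definition is_ascent n (s : {perm 'I_n}) (i : nat) : bool :=
  [&& 1 <= i, i < n & pval s i.-1 < pval s i].
Definition is_descent n (s : {perm 'I_n}) (i : nat) : bool :=
  [&& 1 <= i, i < n & pval s i.-1 > pval s i].

Definition asc_lt n (s : {perm 'I_n}) (j : nat) : nat :=
  count (is_ascent s) (iota 1 j.-1).
Definition des_lt n (s : {perm 'I_n}) (j : nat) : nat :=
  count (is_descent s) (iota 1 j.-1).

Definition nasc n (s : {perm 'I_n}) : nat := count (is_ascent s) (iota 1 n).
Definition ndes n (s : {perm 'I_n}) : nat := count (is_descent s) (iota 1 n).

Definition positive_ud n (s : {perm 'I_n}) : bool :=
  [forall j : 'I_n.+1, asc_lt s j <= des_lt s j].

Definition dyck_ud n (s : {perm 'I_n}) : bool :=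
  (nasc s == (ndes s).+1) && [forall j : 'I_n, asc_lt s j <= des_lt s j].

(* Main.v *)
(** View a permutation as a path with a step up for each descent and a step
down for each ascent, and let [b n] and [d n] count the positive and the Dyck
words on [n] letters.  Appending a last letter to a positive word gives
[n * b (n - 1) = b n + d n].  If [n] is even, a positive path ends at an odd
height [h > 0]; cutting it just before the last letter of height less than [h]
leaves a positive word followed by a reversed Dyck word.  Conversely gluing two
such words, with either an ascent or a descent at the junction, gives a
positive word, because the height before the junction is odd.  Hence
[b n = \sum_i 'C(n, i) * b i * d (n - i)] for even [n].  For
[a m := b (2 m) / (2 m)!], eliminating [d] yields
[\sum_(i <= m) a i * a (m - i) = 1], that is [a m = 'C(2 m, m) / 4 ^ m]. *)

Require Import Defs.
From mathcomp Require Import all_boot all_order all_fingroup.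
From mathcomp Require Import all_algebra.
From mathcomp Require Import zify ring.

Set Implicit Arguments.
Unset Strict Implicit.
Unset Printing Implicit Defensive.

(** * Ascent counts, positive words and Dyck words *)

(* The path has height [k - 2 * asc w k] after [k] steps. *)
Definition asc (w : seq nat) (k : nat) : nat :=
  \sum_(i < k) (nth 0 w i < nth 0 w i.+1).

Definition ballot (w : seq nat) : bool :=
  all (fun k => 2 * asc w k <= k) (iota 0 (size w)).

(* Junk value: [dyck [::]] holds. *)
Definition dyck (w : seq nat) : bool :=
  (2 * asc w (size w).-1 == size w) &&
  all (fun k => 2 * asc w k <= k) (iota 0 (size w).-1).

Definition words (n : nat) : seq (seq nat) := permutations (iota 0 n).

Lemma ascS (w : seq nat) k : asc w k.+1 = asc w k + (nth 0 w k < nth 0 w k.+1).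
Proof. by rewrite /asc big_ord_recr. Qed.

Lemma asc0 (w : seq nat) : asc w 0 = 0.
Proof. by rewrite /asc big_ord0. Qed.

(** The first [k] steps involve [k.+1] letters, hence the strict bound. *)
Lemma asc_take (w : seq nat) i k : k < i -> asc (take i w) k = asc w k.
Proof.
move=> ki; apply: eq_bigr => j _.
by rewrite !nth_take //; have := ltn_ord j; lia.
Qed.

Lemma asc_drop (w : seq nat) i k : asc (drop i w) k + asc w i = asc w (i + k).
Proof.
elim: k => [|k IH]; first by rewrite asc0 addn0.
by rewrite addnS !ascS -IH !nth_drop addnS; lia.
Qed.

Lemma asc_map (f : nat -> nat) (w : seq nat) k : k < size w ->
  {in w &, {mono f : x y / x < y}} -> asc (map f w) k = asc w k.
Proof.
move=> kw fm; apply: eq_bigr => j _.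
have jk := ltn_ord j.
have j1 : j.+1 < size w by lia.
by rewrite !(nth_map 0) ?fm ?mem_nth // ltnW.
Qed.

(** Reversal exchanges ascents and descents: the ascents in the first [k] steps of [rev w] are the
    descents in the last [k] steps of [w]. Distinct letters exclude ties; the sums avoid truncated
    subtraction. *)
Lemma asc_rev (w : seq nat) k : uniq w -> k < size w ->
  asc (rev w) k + asc w (size w).-1 = k + asc w ((size w).-1 - k).
Proof.
move=> uw; elim: k => [|k IH] kw; first by rewrite asc0 subn0.
have {IH} IH := IH (ltnW kw).
have E : (size w).-1 - k = ((size w).-1 - k.+1).+1 by lia.
move: IH; rewrite E !ascS (nth_rev _ kw) (nth_rev _ (ltnW kw)).
have -> : size w - k.+1 = ((size w).-1 - k.+1).+1 by lia.
have -> : size w - k.+2 = (size w).-1 - k.+1 by lia.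
set p := _ - k.+1.
have pw : p.+1 < size w by lia.
have : nth 0 w p != nth 0 w p.+1.
  by rewrite nth_uniq // ?ltn_eqF // ltnW.
by case: ltngtP => //= _ _; lia.
Qed.

Lemma ballotP (w : seq nat) : reflect (forall k, k < size w -> 2 * asc w k <= k) (ballot w).
Proof.
apply: (iffP allP) => H k; first by move=> kw; apply: H; rewrite mem_iota.
by rewrite mem_iota /=; apply: H.
Qed.

Lemma dyckP (w : seq nat) : reflect
  (2 * asc w (size w).-1 = size w /\
   forall k, k < (size w).-1 -> 2 * asc w k <= k) (dyck w).
Proof.
apply: (iffP andP) => -[H1 H2]; split; try exact/eqP.
  by move=> k kw; apply: (allP H2); rewrite mem_iota.
by apply/allP => k; rewrite mem_iota /=; apply: H2.
Qed.

(** Reversing a word reverses the order of the steps and flips their signs. A path that first goes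
    negative at its last step, ending at -1, thus becomes one that stays positive after its start
    and ends at height 1. *)
Lemma dyck_revP (w : seq nat) m : uniq w -> size w = m.+1 -> reflect
  ((2 * asc w m).+1 = m /\ forall k, 0 < k <= m -> 2 * asc w k < k)
  (dyck (rev w)).
Proof.
move=> uw sw; apply: (iffP (dyckP _)); rewrite size_rev sw /= => -[H1 H2].
  have := @asc_rev w m uw; rewrite sw /= subnn asc0 => /(_ (ltnSn _)) H3.
  split; first lia.
  move=> k km; have := @asc_rev w (m - k) uw.
  have Ek : m - (m - k) = k by lia.
  by rewrite sw /= Ek; have := H2 (m - k); lia.
have := @asc_rev w m uw; rewrite sw /= subnn asc0 => /(_ (ltnSn _)) H3.
split; first lia.
move=> k km; have := @asc_rev w k uw; rewrite sw /= => H4.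
by have := H2 (m - k); lia.
Qed.

Lemma asc_step (w : seq nat) k : asc w k <= asc w k.+1 <= (asc w k).+1.
Proof. by rewrite ascS; case: (_ < _); lia. Qed.

Lemma ballot_take (w : seq nat) i : i <= size w -> reflect
  (forall k, k < i -> 2 * asc w k <= k) (ballot (take i w)).
Proof.
move=> iw; apply: (iffP (ballotP _)); rewrite size_takel // => H k ki.
  by rewrite -(@asc_take w i) ?H.
by rewrite asc_take ?H.
Qed.

(** This is [dyck_revP] with heights measured in [w]: after position [i] the path stays strictly
    above its height there, and it ends exactly one higher. *)
Lemma dyck_rev_dropP (w : seq nat) i m : uniq w -> size w = m.+1 -> i <= m -> reflect
  (2 * asc w m + i.+1 = m + 2 * asc w i /\
   forall k, i < k <= m -> 2 * asc w k + i < k + 2 * asc w i)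
  (dyck (rev (drop i w))).
Proof.
move=> uw sw im.
have sd : size (drop i w) = (m - i).+1 by rewrite size_drop; lia.
apply: (iffP (@dyck_revP (@drop nat i w) _ (drop_uniq i uw) sd)) => -[H1 H2].
  have := asc_drop w i (m - i); have -> : i + (m - i) = m by lia.
  move=> H3; split; first lia.
  move=> k ik; have := asc_drop w i (k - i); have -> : i + (k - i) = k by lia.
  by have := H2 (k - i); lia.
have := asc_drop w i (m - i); have -> : i + (m - i) = m by lia.
move=> H3; split; first lia.
move=> k km; have := asc_drop w i k; have := H2 (i + k); lia.
Qed.

(** * Decompositions of a positive word *)

(** The sum of indicators states at once that a positive word has exactly one admissible cut and
    that any other word has none. *)
Lemma ballot_cut (w : seq nat) : uniq w -> 0 < size w -> ~~ odd (size w) ->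
  (ballot w : nat) =
    \sum_(i < size w) (ballot (take i w) && dyck (rev (drop i w))).
Proof.
case sw : (size w) => [//|m] uw _ em.
have cutP (i : 'I_m.+1) := @dyck_rev_dropP w i m uw sw (ltn_ord i).
have takeP (i : 'I_m.+1) := @ballot_take w i.
case: (boolP (ballot w)) => [/ballotP|] Hw; rewrite ?sw in Hw.
  (* The cut is at the last position lying below the final height. *)
  pose low k := (k <= m) && (2 * asc w m + k < m + 2 * asc w k).
  (* Position 0 is low: the number [m] of steps is odd, so the nonnegative final height is odd,
     hence positive. *)
  have low0 : exists k, low k.
    exists 0; rewrite /low asc0 /=; have := Hw m (ltnSn _); lia.
  have [|i /andP[im li] imax] := @ex_maxnP low m low0.
    by move=> k /andP[].
  have i_ne : i <> m by move=> E; move: li; rewrite E; lia.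
  have hi k : i < k <= m -> m + 2 * asc w k <= 2 * asc w m + k.
    move=> ik; rewrite leqNgt; apply/negP => lk.
    by have := imax k; rewrite /low lk; lia.
  (* Steps have size one, so between the last low position and the next one the height goes from
     just below the final height to exactly it. *)
  have iE : 2 * asc w m + i.+1 = m + 2 * asc w i.
    by have := hi i.+1; have := asc_step w i; lia.
  have bi : ballot (take i w).
    by apply/ballot_take => [|k ki]; [|apply: Hw]; lia.
  have di : dyck (rev (drop i w)).
    apply/(@dyck_rev_dropP w i m) => //; split=> // k ik.
    by have := hi k ik; lia.
  rewrite (bigD1 (Ordinal (im : i < m.+1))) //= bi di big1 ?addn0 //.
  (* Any cut lies one below the final height. A cut [j < i] would force [i] strictly higher than
     [j], yet both have that height; for [j > i] the height is no longer below the final one. *)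
  move=> j; rewrite -val_eqE /= => ji; case: cutP => [[H1 H2]|]; last by rewrite andbF.
  exfalso; have := ltn_ord j; case: (ltngtP j i) ji => // ji _ jm.
    by have := H2 i; lia.
  by have := hi j; lia.
rewrite big1 // => i _; case: cutP => [[H1 H2]|]; last by rewrite andbF.
have im := ltn_ord i.
case: takeP => [|H|//]; first lia.
case/negP: Hw; apply/ballotP => k; rewrite sw => km.
(* Before [i] the prefix decides. At [i] the height is at least -1, being one step past the prefix,
   and it is even, being one below the odd final height; so it is nonnegative. After [i] the path
   stays above it. *)
case: (ltngtP k i) => [/H //|ik|->].
  have := H2 k; case: (posnP i) => [i0|i0]; first by move: H1; rewrite i0 asc0; lia.
  have := asc_step w i.-1; have := H i.-1; rewrite prednK //.
  by move: em => /=; lia.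
case: (posnP i) => [->|i0]; first by rewrite asc0.
have := asc_step w i.-1; have := H i.-1; rewrite prednK //.
by move: em => /=; lia.
Qed.

(** From a nonnegative height, the last step leads either to a nonnegative height or to exactly -1,
    and these are the two exclusive cases on the right. *)
Lemma ballot_last (w : seq nat) n : size w = n.+1 ->
  (ballot (take n w) : nat) = ballot w + dyck w.
Proof.
move=> sw.
case: (ballot_take (w := w) (i := n)) => [|H|H]; first lia.
- case: dyckP; rewrite sw /= => Hd; case: ballotP; rewrite sw => Hb //.
  + by exfalso; case: Hd; have := Hb n; lia.
  + exfalso; case: n sw H Hd Hb => [|n] sw H Hd Hb.
      by apply: Hb => -[|//]; rewrite asc0.
    apply: Hb => k; rewrite ltnS leq_eqVlt => /predU1P[->|/H //].
    rewrite leqNgt; apply/negP => lt; apply: Hd; split => //.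
    by have := H n; have := asc_step w n; lia.
- case: dyckP; rewrite sw /= => Hd; first by case: H; case: Hd.
  case: ballotP; rewrite sw => Hb //.
  by case: H => k kn; apply: Hb; lia.
Qed.

(** * Counting words by the letters of a prefix *)

Lemma mem_words n w : (w \in words n) = perm_eq w (iota 0 n).
Proof. exact: mem_permutations. Qed.

Lemma words_uniq n w : w \in words n -> uniq w.
Proof. by rewrite mem_words => /perm_uniq->; apply: iota_uniq. Qed.

Lemma words_size n w : w \in words n -> size w = n.
Proof. by rewrite mem_words => /perm_size->; apply: size_iota. Qed.

Lemma ballot_map (f : nat -> nat) (w : seq nat) :
  {in w &, {mono f : x y / x < y}} -> ballot (map f w) = ballot w.
Proof.
move=> fm; rewrite /ballot size_map; apply: eq_in_all => k.
by rewrite mem_iota => /= kw; rewrite asc_map.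
Qed.

Lemma dyck_map (f : nat -> nat) (w : seq nat) : 0 < size w ->
  {in w &, {mono f : x y / x < y}} -> dyck (map f w) = dyck w.
Proof.
move=> w0 fm; rewrite /dyck size_map asc_map ?prednK //; congr andb.
apply: eq_in_all => k.
by rewrite mem_iota => /= kw; rewrite asc_map //; lia.
Qed.

Lemma permutations_map (S T : eqType) (f : S -> T) (s : seq S) :
  uniq s -> {in s &, injective f} ->
  perm_eq (permutations (map f s)) (map (map f) (permutations s)).
Proof.
move=> us fI; rewrite perm_sym.
have uf : uniq (map (map f) (permutations s)).
  rewrite map_inj_in_uniq ?permutations_uniq // => u v.
  rewrite !mem_permutations => /perm_mem pu /perm_mem pv.
  by apply: (inj_in_map fI); apply/allP => x; rewrite ?pu ?pv.
apply: uniq_perm; rewrite ?permutations_uniq //.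
apply: (uniq_min_size uf _ _).2; last first.
  by rewrite size_map !size_permutations ?size_map // map_inj_in_uniq.
by move=> _ /mapP[u + ->]; rewrite !mem_permutations => /perm_map.
Qed.

(** The increasing relabelling [nth 0 s] carries the standard alphabet to [s], and [P] sees only the
    relative order of letters. *)
Lemma count_permutations_sorted (P : pred (seq nat)) (s : seq nat) :
  sorted ltn s ->
  (forall (f : nat -> nat) w, size w = size s ->
    {in w &, {mono f : x y / x < y}} -> P (map f w) = P w) ->
  count P (permutations s) = count P (words (size s)).
Proof.
move=> ss Pm; have us := sorted_uniq ltn_trans ltnn ss.
have sE : s = map (nth 0 s) (iota 0 (size s)) by rewrite map_nth_iota0 ?take_size.
have nm : {in iota 0 (size s) &, {mono nth 0 s : x y / x < y}}.
  move=> x y; rewrite !mem_iota /= => xs ys.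
  have nth_lt := sorted_ltn_nth ltn_trans 0 ss.
  case: (ltngtP x y) => [xy|yx|->]; last exact: ltnn.
    exact: nth_lt xy.
  by apply/negbTE; rewrite -leqNgt ltnW //; apply: nth_lt yx.
have nI : {in iota 0 (size s) &, injective (nth 0 s)}.
  by move=> x y; rewrite !mem_iota /= => xs ys /eqP; rewrite nth_uniq // => /eqP.
rewrite {1}sE (seq.permP (permutations_map (iota_uniq 0 (size s)) nI)).
rewrite count_map; apply: eq_in_count => w.
rewrite mem_permutations => pw /=.
apply: Pm; first by rewrite (perm_size pw) size_iota.
by move=> x y; rewrite !(perm_mem pw); apply: nm.
Qed.

Definition set_word n (A : {set 'I_n}) : seq nat := map val (enum A).

Lemma set_word_sorted n (A : {set 'I_n}) : sorted ltn (set_word A).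
Proof.
rewrite /set_word; apply: (subseq_sorted ltn_trans (s2 := iota 0 n)).
  by rewrite -val_enum_ord map_subseq // enumT filter_subseq.
exact: iota_ltn_sorted.
Qed.

Lemma set_word_uniq n (A : {set 'I_n}) : uniq (set_word A).
Proof. exact: (sorted_uniq ltn_trans ltnn (set_word_sorted A)). Qed.

Lemma mem_set_word n (A : {set 'I_n}) (i : 'I_n) : (val i \in set_word A) = (i \in A).
Proof. by rewrite mem_map ?mem_enum //; apply: val_inj. Qed.

Lemma size_set_word n (A : {set 'I_n}) : size (set_word A) = #|A|.
Proof. by rewrite size_map cardE. Qed.

Lemma set_wordC n (A : {set 'I_n}) :
  perm_eq (set_word A ++ set_word (~: A)) (iota 0 n).
Proof.
apply: uniq_perm; rewrite ?iota_uniq // ?cat_uniq ?set_word_uniq ?andbT //=.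
  apply/hasPn => _ /mapP[i + ->]; rewrite mem_enum inE => iA.
  by rewrite /= mem_set_word.
move=> k; rewrite mem_cat mem_iota add0n /=; apply/orP/idP => [[]|kn].
- by case/mapP => i _ ->; apply: ltn_ord.
- by case/mapP => i _ ->; apply: ltn_ord.
have /= -> := mem_set_word A (Ordinal kn).
have /= -> := mem_set_word (~: A) (Ordinal kn).
by rewrite inE; apply/orP; case: (_ \in A).
Qed.

(** Once the set of letters of the prefix is fixed, prefix and suffix vary independently:
    concatenation is a bijection from pairs of arrangements of [A] and of its complement. *)
Lemma count_words_fiber (P Q : pred (seq nat)) n (A : {set 'I_n}) :
  count (fun w => [&& P (take #|A| w), Q (drop #|A| w) &
                      [set k : 'I_n | val k \in take #|A| w] == A]) (words n) =
  count P (permutations (set_word A)) * count Q (permutations (set_word (~: A))).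
Proof.
rewrite -!size_filter -(size_allpairs cat); apply: perm_size.
apply: uniq_perm.
- by rewrite filter_uniq ?permutations_uniq.
- apply: allpairs_uniq; rewrite ?filter_uniq ?permutations_uniq //.
  move=> _ _ /allpairsP[[u v] /= [+ _ ->]] /allpairsP[[u' v'] /= [+ _ ->]].
  rewrite !mem_filter !mem_permutations => /andP[_ /perm_size su] /andP[_ /perm_size su'].
  by move=> /eqP; rewrite eqseq_cat ?su // => /andP[/eqP-> /eqP->].
move=> w; rewrite mem_filter mem_words; apply/andP/allpairsP => /=.
  case=> /and3P[Pw Qw /eqP wA] pw.
  have uw : uniq w by rewrite (perm_uniq pw) iota_uniq.
  have memA (j : 'I_n) : (val j \in take #|A| w) = (j \in A).
    by rewrite -[in RHS]wA inE.
  have ptA : perm_eq (take #|A| w) (set_word A).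
    apply: uniq_perm; rewrite ?take_uniq ?set_word_uniq // => k.
    apply/idP/idP => [kw|/mapP[i + ->]]; last first.
      by rewrite mem_enum memA.
    have kn : k < n.
      by move/mem_take: kw; rewrite (perm_mem pw) mem_iota.
    have /= -> := mem_set_word A (Ordinal kn).
    by rewrite -memA.
  exists (take #|A| w, drop #|A| w); rewrite /= cat_take_drop.
  rewrite !mem_filter Pw Qw /= !mem_permutations ptA; split=> //.
  rewrite -(perm_cat2l (set_word A)).
  rewrite (perm_trans _ (_ : perm_eq w _)) //; last first.
    by rewrite (perm_trans pw) // perm_sym set_wordC.
  by rewrite -{2}(cat_take_drop #|A| w) perm_cat2r perm_sym.
case=> [[u v] /= []]; rewrite !mem_filter !mem_permutations.
move=> /andP[Pu pu] /andP[Qv pv] ->.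
have su : size u = #|A| by rewrite (perm_size pu) size_set_word.
rewrite take_size_cat // drop_size_cat // Pu Qv /=; split.
  by apply/eqP/setP => k; rewrite inE (perm_mem pu) mem_set_word.
exact: perm_trans (perm_cat pu pv) (set_wordC A).
Qed.

(** The words are sorted by the letter set of their prefix. By order invariance each of the
    ['C(n, i)] sets contributes the same product. *)
Lemma count_words_cut (P Q : pred (seq nat)) n i : i <= n ->
  (forall (f : nat -> nat) w, size w = i ->
    {in w &, {mono f : x y / x < y}} -> P (map f w) = P w) ->
  (forall (f : nat -> nat) w, size w = n - i ->
    {in w &, {mono f : x y / x < y}} -> Q (map f w) = Q w) ->
  count (fun w => P (take i w) && Q (drop i w)) (words n) =
  'C(n, i) * (count P (words i) * count Q (words (n - i))).
Proof.
move=> ile Pm Qm.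
have cA (A : {set 'I_n}) : #|A| = i -> #|~: A| = n - i.
  by move=> Ai; rewrite cardsCs setCK Ai card_ord.
transitivity (\sum_(A : {set 'I_n} | #|A| == i)
    count P (permutations (set_word A)) *
    count Q (permutations (set_word (~: A)))); last first.
  rewrite -[in 'C(n, i)](card_ord n) -card_draws -sum_nat_const.
  apply: eq_big => [A|A /eqP Ai]; first by rewrite inE.
  have sA := size_set_word A; have sC := size_set_word (~: A).
  rewrite Ai in sA; rewrite (cA _ Ai) in sC.
  rewrite (@count_permutations_sorted P (set_word A)) ?set_word_sorted ?sA //.
  by rewrite (@count_permutations_sorted Q (set_word (~: A))) ?set_word_sorted ?sC.
rewrite -sum1_count big_seq_cond.
rewrite (partition_big (fun w => [set k : 'I_n | val k \in take i w])
  (fun A => #|A| == i)) /=; last first.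
  move=> w /andP[ww _]; have sw : size (take i w) = i.
    by rewrite size_takel // (words_size ww).
  have ut := take_uniq i (words_uniq ww).
  rewrite -size_set_word -[X in _ == X]sw; apply/eqP/perm_size.
  apply: uniq_perm => //; first exact: set_word_uniq.
  move=> k; apply/mapP/idP => [[j + ->]|kw]; first by rewrite mem_enum inE.
  have kn : k < n.
    by move/mem_take: kw; move: ww; rewrite mem_words => /perm_mem->; rewrite mem_iota.
  by exists (Ordinal kn); rewrite // mem_enum inE.
apply: eq_bigr => A /eqP Ai.
rewrite -count_words_fiber sum1_count Ai.
by apply: eq_in_count => w ww; rewrite ww /= -andbA.
Qed.

Lemma count_words_rev (P : pred (seq nat)) n :
  count (fun w => P (rev w)) (words n) = count P (words n).
Proof.
rewrite -count_map; apply/seq.permP; apply: uniq_perm; rewrite ?permutations_uniq //.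
  by rewrite map_inj_uniq ?permutations_uniq //; apply: inv_inj; apply: revK.
move=> w; rewrite mem_words; apply/mapP/idP => [[u + ->]|pw].
  by rewrite mem_words perm_rev.
by exists (rev w); rewrite ?revK // mem_words perm_rev.
Qed.

(** * Recurrences for the numbers of positive and Dyck words *)

Definition nballot (n : nat) : nat := count ballot (words n).
Definition ndyck (n : nat) : nat := count dyck (words n).

Lemma count_sum (T : Type) (P : pred T) s : count P s = \sum_(x <- s) P x.
Proof. by elim: s => [|x s IH]; rewrite ?big_nil // big_cons /= IH. Qed.

Lemma ndyck_odd n : odd n -> ndyck n = 0.
Proof.
move=> on; apply/eqP; rewrite -leqn0 leqNgt -has_count; apply/hasPn => w.
by move/words_size => sw; apply/negP => /dyckP[]; rewrite sw; lia.
Qed.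

Lemma nballotS n : n.+1 * nballot n = nballot n.+1 + ndyck n.+1.
Proof.
(* The last letter is unconstrained: [predT] counts the only one-letter word, and ['C(n.+1, n)]
   accounts for the value of the letter. *)
have := @count_words_cut ballot predT n.+1 n (leqnSn n).
move=> /(_ (fun f w _ => @ballot_map f w)) /(_ (fun _ _ _ _ => erefl)).
rewrite binSn subSn // subnn count_predT /= muln1 => <-.
rewrite /nballot /ndyck !count_sum -big_split /=.
rewrite big_seq [RHS]big_seq; apply: eq_bigr => w ww.
by rewrite andbT (ballot_last (words_size ww)).
Qed.

Lemma nballot_cut n : 0 < n -> ~~ odd n ->
  nballot n = \sum_(i < n) 'C(n, i) * (nballot i * ndyck (n - i)).
Proof.
move=> n0 en.
transitivity (\sum_(i < n)
  count (fun w => ballot (take i w) && dyck (rev (drop i w))) (words n)).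
  rewrite /nballot count_sum; under [RHS]eq_bigr do rewrite count_sum.
  rewrite exchange_big big_seq [RHS]big_seq; apply: eq_bigr => w ww.
  by have := ballot_cut (words_uniq ww); rewrite (words_size ww); apply.
apply: eq_bigr => i _; have im := ltn_ord i.
rewrite -[ndyck _](@count_words_rev dyck).
apply: (@count_words_cut ballot (fun w => dyck (rev w))); first exact: ltnW.
  by move=> f w _; apply: ballot_map.
move=> f w sw fm; rewrite -map_rev dyck_map ?size_rev ?sw ?subn_gt0 //.
by move=> x y; rewrite !mem_rev; apply: fm.
Qed.

(** * Solving the recurrences over the rationals *)

Import GRing.Theory Num.Theory.
Local Open Scope ring_scope.

(** In terms of the generating function, the hypotheses say A^2 = 1/(1-x). Differentiating gives
    2(1-x)A' = A, whose coefficients are the conclusion; the proof does this on finite sums. *)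
Lemma convolution_square_const_rec (a : nat -> rat) :
  a 0%N = 1 ->
  (forall m, \sum_(i < m.+2) a i * a (m.+1 - i)%N = \sum_(i < m.+1) a i * a (m - i)%N) ->
  forall m, (2 * m.+1)%N%:R * a m.+1 = (2 * m).+1%N%:R * a m.
Proof.
move=> a0 aT m.
pose T m := \sum_(i < m.+1) a i * a (m - i)%N.
have T1 k : T k = 1.
  elim: k => [|k IH]; first by rewrite /T big_ord1 a0 mulr1.
  by rewrite -IH /T aT.
(* Adding the sum to its image under [i -> k - i] makes the weight constant. *)
have sym k : \sum_(i < k.+1) (2 * i)%N%:R * (a i * a (k - i)%N) = k%:R.
  rewrite -[RHS]mulr1 -[X in _ = _ * X](T1 k) mulr_sumr.
  under eq_bigr => i _ do rewrite mul2n -addnn natrD mulrDl.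
  rewrite big_split /= [X in _ + X](reindex_inj rev_ord_inj) /= -big_split /=.
  apply: eq_bigr => i _; have ik := ltn_ord i.
  rewrite subSS subKn -1?ltnS // [a (k - i)%N * _]mulrC -mulrDl -natrD.
  by rewrite subnKC -1?ltnS.
elim/ltn_ind: m => m IH.
(* Two sums equal [m.+1]: the one of weight [2 * i] at level [m.+1], shifted by one index, and the
   one of weight [2 * i + 1] at level [m]. By induction they agree term by term up to the last, so
   their last terms agree too. *)
have := sym m.+1; rewrite big_ord_recl mul0r add0r big_ord_recr /= subnn a0 mulr1.
under eq_bigr => i _.
  rewrite mulrA IH // subSS -mulrA.
  over.
have : \sum_(i < m.+1) (2 * i).+1%N%:R * (a i * a (m - i)%N) = m.+1%:R.
  under eq_bigr => i _ do rewrite -natr1 mulrDl mul1r.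
  by rewrite big_split /= sym -/(T m) T1 natr1.
rewrite big_ord_recr /= subnn a0 mulr1 => H1 H2.
by apply: (addrI (\sum_(i < m) (2 * i).+1%N%:R * (a i * a (m - i)%N))); rewrite H1.
Qed.

Lemma sum_double (V : nmodType) (F : nat -> V) m :
  \sum_(i < m.*2) F i = \sum_(i < m) (F i.*2 + F i.*2.+1).
Proof.
elim: m => [|m IH]; first by rewrite !big_ord0.
by rewrite doubleS !big_ord_recr /= IH addrA.
Qed.

Lemma nballot_double_rec m :
  nballot m.*2.+2 = (m.*2.+1 ^ 2 * nballot m.*2)%N.
Proof.
(* Division by the factorial turns the binomial convolution into an ordinary one. *)
pose a k : rat := (nballot k.*2)%:R / (k.*2)`!%:R.
pose e k : rat := (ndyck k.*2)%:R / (k.*2)`!%:R.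
have fact_neq0 k : k`!%:R != 0 :> rat by rewrite pnatr_eq0 -lt0n fact_gt0.
have a0 : a 0%N = 1 by rewrite /a divr1.
have aD k : a k = a k.+1 + e k.+1.
  rewrite /a /e -mulrDl doubleS -natrD -nballotS.
  have -> : nballot k.*2.+1 = (k.*2.+1 * nballot k.*2)%N.
    by rewrite nballotS ndyck_odd ?addn0 //= odd_double.
  rewrite !factS !natrM -[in RHS]mulf_div divff ?pnatr_eq0 // mul1r.
  by rewrite -[in RHS]mulf_div divff ?pnatr_eq0 // mul1r.
have aC k : a k.+1 = \sum_(i < k.+1) a i * e (k.+1 - i)%N.
  rewrite {1}/a nballot_cut ?odd_double // natr_sum.
  rewrite (sum_double (fun i => ('C(k.+1.*2, i) *
    (nballot i * ndyck (k.+1.*2 - i)))%N%:R : rat)) mulr_suml.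
  apply: eq_bigr => i _; have ik := ltn_ord i.
  (* A prefix of odd length leaves a Dyck block of odd length, so only even indices contribute. *)
  have od : odd (k.+1.*2 - i.*2.+1) by lia.
  rewrite (ndyck_odd od).
  have ik2 : (i.*2 <= k.+1.*2)%N by lia.
  have C0 : 'C(k.+1.*2, i.*2)%:R != 0 :> rat.
    by rewrite pnatr_eq0 -lt0n bin_gt0.
  rewrite !muln0 addr0 /a /e doubleB -(bin_fact ik2) !natrM.
  by rewrite -[LHS]mulf_div divff // mul1r -mulf_div.
(* The last term [a k.+1 * a 0] is expanded by [aC]; each [a (k.+1 - i) + e (k.+1 - i)] then
   collapses to [a (k - i)] by [aD]. *)
have aT k : \sum_(i < k.+2) a i * a (k.+1 - i)%N = \sum_(i < k.+1) a i * a (k - i)%N.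
  rewrite big_ord_recr /= subnn a0 mulr1 aC -big_split /=; apply: eq_bigr => i _.
  by rewrite -mulrDr subSn -1?ltnS // -aD.
have := convolution_square_const_rec a0 aT m; rewrite /a mul2n doubleS mul2n !factS !natrM => H.
apply/eqP; rewrite -(eqr_nat rat) natrM natrX; apply/eqP.
(* Here [x], [y], [f] stand for [m.*2.+2], [m.*2.+1] and the factorial of [m.*2]. *)
have solve (x y f b c : rat) : x != 0 -> y != 0 -> f != 0 ->
  x * (c / (x * (y * f))) = y * (b / f) -> c = y ^+ 2 * b.
  move=> x0 y0 f0 E; transitivity (x * (c / (x * (y * f))) * (y * f)).
    by field; rewrite ?f0 ?x0 ?y0.
  by rewrite E; field.
by apply: solve H; rewrite ?fact_neq0 ?pnatr_eq0.
Qed.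

Local Close Scope ring_scope.

(** * Closed forms with double factorials *)

(** At [m = 0] the truncated [m.*2 - 1] is 0, and [dfact 0 = 1] supplies the value of (-1)!!. *)
Lemma dfact_oddS m : dfact m.*2.+1 = m.*2.+1 * dfact (m.*2 - 1).
Proof. by case: m => [//|m]; rewrite doubleS subn1. Qed.

Lemma nballot_double m : nballot m.*2 = dfact (m.*2 - 1) ^ 2.
Proof.
elim: m => [//|m IH].
by rewrite doubleS nballot_double_rec IH subSS subn0 dfact_oddS expnMn.
Qed.

Lemma nballot_doubleS m : nballot m.*2.+1 = dfact m.*2.+1 * dfact (m.*2 - 1).
Proof.
have od : odd m.*2.+1 by rewrite /= odd_double.
have := nballotS m.*2; rewrite (ndyck_odd od) addn0 => <-.
by rewrite nballot_double dfact_oddS expnS expn1 mulnA.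
Qed.

(** With D = (2m-1)!!, [nballotS] gives (2m+2)(2m+1)D^2 - (2m+1)^2 D^2 = (2m+1)D^2. *)
Lemma ndyck_double m : ndyck m.*2.+2 = dfact m.*2.+1 * dfact (m.*2 - 1).
Proof.
have := nballotS m.*2.+1.
rewrite nballot_double_rec nballot_double nballot_doubleS dfact_oddS.
nia.
Qed.

(** * From permutations to words *)

Definition perm_word n (s : {perm 'I_n}) : seq nat :=
  [seq val (s i) | i <- enum 'I_n].

Lemma size_perm_word n (s : {perm 'I_n}) : size (perm_word s) = n.
Proof. by rewrite size_map size_enum_ord. Qed.

Lemma nth_perm_word n (s : {perm 'I_n}) (i : 'I_n) :
  nth 0 (perm_word s) i = s i.
Proof. by rewrite (nth_map i) ?size_enum_ord // nth_ord_enum. Qed.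

Lemma pval_nth n (s : {perm 'I_n}) k : Defs.pval s k = nth 0 (perm_word s) k.
Proof.
rewrite /Defs.pval; case: insubP => [i _ <-|]; first by rewrite nth_perm_word.
by rewrite -leqNgt => nk; rewrite nth_default // size_perm_word.
Qed.

Lemma perm_word_inj n : injective (@perm_word n).
Proof.
move=> s t st; apply/permP => i; apply: val_inj.
by rewrite /= -!nth_perm_word st.
Qed.

Lemma perm_word_in n (s : {perm 'I_n}) : perm_word s \in words n.
Proof.
rewrite mem_words -val_enum_ord /perm_word (map_comp val s) perm_map //.
have eu := enum_uniq 'I_n.
apply: uniq_perm => [||i]; rewrite ?(map_inj_uniq (@perm_inj _ s)) //.
rewrite mem_enum; apply/mapP; exists (s^-1%g i).
  by rewrite mem_enum.
by rewrite permKV.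
Qed.

Lemma card_perm_word (P : pred (seq nat)) n :
  #|[set s : {perm 'I_n} | P (perm_word s)]| = count P (words n).
Proof.
have pe : perm_eq (map (@perm_word n) (enum {perm 'I_n})) (words n).
  have u : uniq (map (@perm_word n) (enum {perm 'I_n})).
    by rewrite map_inj_uniq ?enum_uniq //; apply: perm_word_inj.
  apply: uniq_perm; rewrite ?permutations_uniq //.
  apply: (uniq_min_size u _ _).2.
    by move=> _ /mapP[s _ ->]; apply: perm_word_in.
  by rewrite size_permutations ?iota_uniq // size_iota size_map -cardE card_Sn.
rewrite cardsE cardE -(seq.permP pe) count_map -size_filter.
by congr size; rewrite !enumT; apply: eq_filter.
Qed.

Lemma count_iotaS (p : pred nat) m k :
  count p (iota m k.+1) = count p (iota m k) + p (m + k).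
Proof. by rewrite -(addn1 k) iotaD count_cat /= addn0. Qed.

Lemma count_ascent n (s : {perm 'I_n}) k : k < n ->
  count (is_ascent s) (iota 1 k) = asc (perm_word s) k.
Proof.
move=> kn; elim: k kn => [|k IH] kn; first by rewrite asc0.
rewrite count_iotaS IH ?(ltnW kn) // ascS.
by rewrite /is_ascent !pval_nth add1n kn.
Qed.

(** Distinct letters make every step an ascent or a descent, so the ascent count determines the
    height. *)
Lemma count_descent n (s : {perm 'I_n}) k : k < n ->
  count (is_descent s) (iota 1 k) + asc (perm_word s) k = k.
Proof.
move=> kn; elim: k kn => [|k IH] kn; first by rewrite asc0.
rewrite count_iotaS ascS.
rewrite [X in _ + nat_of_bool X]/is_descent !pval_nth add1n kn /=.
rewrite -[RHS]addn1 -[in RHS](IH (ltnW kn)).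
have : nth 0 (perm_word s) k != nth 0 (perm_word s) k.+1.
  by rewrite nth_uniq ?size_perm_word ?ltn_eqF ?(ltnW kn) // (words_uniq (perm_word_in s)).
by case: ltngtP => //= _ _; lia.
Qed.

Lemma positive_udE n (s : {perm 'I_n}) : 0 < n ->
  positive_ud s = ballot (perm_word s).
Proof.
move=> n0; apply/forallP/ballotP; rewrite size_perm_word => H k.
  (* The indices less than [k.+1] are the first [k] steps, so the bound [j] corresponds to [j.-1]
     steps. *)
  move=> kn; have := H (Ordinal (kn : k.+1 < n.+1)).
  by rewrite /asc_lt /des_lt /= count_ascent //; have := count_descent s kn; lia.
have kn : k.-1 < n by have := ltn_ord k; lia.
rewrite /asc_lt /des_lt count_ascent //.
by have := count_descent s kn; have := H _ kn; lia.
Qed.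

Lemma dyck_udE n (s : {perm 'I_n}) : 0 < n -> dyck_ud s = dyck (perm_word s).
Proof.
case: n s => // n s _.
(* [nasc] also inspects the index equal to the length, which is never an ascent. *)
have na : nasc s = asc (perm_word s) n.
  rewrite /nasc count_iotaS count_ascent //.
  by rewrite /is_ascent add1n ltnn addn0.
have nd : ndes s + asc (perm_word s) n = n.
  rewrite /ndes count_iotaS [X in _ + nat_of_bool X]/is_descent add1n ltnn /= addn0.
  exact: count_descent.
apply/andP/dyckP; rewrite size_perm_word /= na => -[H1 H2]; split.
- by move/eqP: H1; lia.
- move=> k kn; have /forallP/(_ (Ordinal (kn : k.+1 < n.+1))) := H2.
  have kn1 : k < n.+1 by lia.
  rewrite /asc_lt /des_lt /= (count_ascent s kn1).
  by have := count_descent s kn1; lia.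
- by apply/eqP; lia.
apply/forallP => k; have kn : k.-1 < n.+1 by have := ltn_ord k; lia.
rewrite /asc_lt /des_lt count_ascent //.
have := count_descent s kn; have := H2 k.-1; have := ltn_ord k.
by case: (val k) => [|j] /=; rewrite ?asc0; lia.
Qed.

Theorem theorem6 (n : nat) (hn : 0 < n) :
  #|[set s : {perm 'I_n} | positive_ud s]| =
    (if odd n then dfact n * dfact (n - 2) else dfact (n - 1) ^ 2)
  /\
  #|[set s : {perm 'I_n} | dyck_ud s]| =
    (if odd n then 0 else dfact (n - 1) * dfact (n - 3)).
Proof.
have -> : #|[set s : {perm 'I_n} | positive_ud s]| = nballot n.
  by rewrite /nballot -card_perm_word; apply: eq_card => s; rewrite !inE positive_udE.
have -> : #|[set s : {perm 'I_n} | dyck_ud s]| = ndyck n.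
  by rewrite /ndyck -card_perm_word; apply: eq_card => s; rewrite !inE dyck_udE.
have nE := odd_double_half n; case: ifP nE => on; set m := n./2 => nE.
  by rewrite ndyck_odd // -nE add1n nballot_doubleS; split=> //.
move: hn; rewrite -nE add0n; case: m {nE} => [//|m] _.
by rewrite nballot_double doubleS ndyck_double !subSS subn0.
Qed.
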